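(* Let $N\ge2$ and consider the flat clusteron with one violinist in each of the rooms $0,1,\dots,N-1$. A state is a final state reachable from this flat clusteron if and only if it is one of the following: (i) the state with shadow $F_{N,1}$ whose leftmost violinist is in room $-N+1$; (ii) the state with shadow $F_{N,N-1}$ whose leftmost violinist is in room $-1$; (iii) for some $1\le r\le N-1$ and some integer $k$ with $-N+2\le k\le -2$, the state with shadow $F_{N,r}$ whose leftmost violinist is in room $k$.
   Context: Rooms are indexed by the integers, room $i$ being adjacent to rooms $i-1$ and $i+1$. A state is a placement of finitely many indistinguishable violinists in rooms: a function $a:\mathbb{Z}\to\mathbb{Z}_{\ge0}$ with finite support, $a_i$ the number of violinists in room $i$. Room $i$ is occupied if $a_i\ge1$. A move is possible whenever two adjacent rooms $i,i+1$ are both occupied: one violinist leaves room $i$ and goes to the nearest unoccupied room to the left of $i$, and one violinist leaves room $i+1$ and goes to the nearest unoccupied room to the right of $i+1$. A state is final if no move is possible. A state is reachable from $S$ if it is obtained from $S$ by a finite (possibly empty) sequence of moves. A flat clusteron is a state in which a set of consecutive rooms each contain exactly one violinist and all other rooms are empty. For a state with at most one violinist per room, its shadow is the $0/1$ word recording occupancy of rooms from its leftmost to its rightmost occupied room. For $N\ge2$ and $1\le k\le N-1$, $F_{N,k}$ denotes the shadow with $N$ ones in which consecutive ones are separated by a single $0$, except that the $k$-th and $(k+1)$-st ones are separated by $00$ (e.g. $F_{3,2}=101001$). *)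

(* Defs.v *)
From Stdlib Require Export Relation_Operators.
From mathcomp Require Export all_boot all_order all_algebra.
From mathcomp Require Export finmap.

Set Implicit Arguments.
Unset Strict Implicit.
Unset Printing Implicit Defensive.

Import Order.TTheory GRing.Theory Num.Theory.

Local Open Scope ring_scope.

Definition state := {fsfun int -> nat with 0%N}.

Definition occupied (a : state) (i : int) : bool := (1 <= a i)%N.

Definition nearest_left (a : state) (i p : int) : Prop :=
  [/\ p < i, ~~ occupied a p & forall j : int, p < j < i -> occupied a j].

Definition nearest_right (a : state) (i q : int) : Prop :=
  [/\ i < q, ~~ occupied a q & forall j : int, i < j < q -> occupied a j].

(* The booleans are read as 0 or 1; the truncated subtractions never
   underflow, since rooms i and i + 1 are distinct and occupied. *)
Definition move_at (a : state) (i : int) (b : state) : Prop :=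
  [/\ occupied a i, occupied a (i + 1) &
    exists p q : int,
      [/\ nearest_left a i p, nearest_right a (i + 1) q &
        forall j : int,
          b j = (a j - (j == i) - (j == (i + 1)%R) + (j == p) + (j == q))%N]].

Definition move (a b : state) : Prop := exists i : int, move_at a i b.

Definition final (a : state) : Prop := ~ exists b : state, move a b.

Definition reachable : state -> state -> Prop := clos_refl_trans_1n state move.

Definition flat_clusteron (m : int) (n : nat) : state :=
  [fsfun i in [fset (m + j%:Z)%R | j in iota 0 n]%fset => 1%N | 0%N].

Definition at_most_one (a : state) : Prop := forall i : int, (a i <= 1)%N.

Definition leftmost (a : state) (l : int) : Prop :=
  occupied a l /\ forall j : int, occupied a j -> l <= j.

Definition rightmost (a : state) (r : int) : Prop :=
  occupied a r /\ forall j : int, occupied a j -> j <= r.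

Definition has_shadow (a : state) (w : seq bool) : Prop :=
  at_most_one a /\
  exists l r : int,
    [/\ leftmost a l, rightmost a r &
      w = mkseq (fun i => occupied a (l + i%:Z)) (absz (r - l)).+1].

(* F N k: the j-th gap, between the j-th and (j+1)-st ones, is 00 for j = k
   and 0 for every other j in 1, ..., N - 1. *)
Definition F (N k : nat) : seq bool :=
  true :: flatten [seq (if j == k then [:: false; false; true]
                        else [:: false; true]) | j <- iota 1 N.-1].

Lemma flat_clusteronE (m : int) (n : nat) (i : int) :
  flat_clusteron m n i = (m <= i < m + n%:Z).
Proof.
rewrite /flat_clusteron fsfunE.
suff -> : (i \in [fset (m + j%:Z)%R | j in iota 0 n]%fset)
          = (m <= i < m + n%:Z).
  by case: ifP.
apply/imfsetP/andP => [[j /=]|[le_mi lt_in]].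
  by rewrite mem_iota add0n => /= ltjn ->; rewrite lerDl ltrD2l.
exists `|i - m|%N; last by rewrite gez0_abs ?subr_ge0 // (addrC m) subrK.
by rewrite /= mem_iota /= add0n -ltz_nat gez0_abs ?subr_ge0 // ltrBlDl.
Qed.

Example F_3_2 : F 3 2 = [:: true; false; true; false; false; true].
Proof. by []. Qed.

(* Main.v *)
(* A move brings the two empty ends of a full block together into a double gap
   inside it. Hence every move leaves a double gap, and between two double gaps
   there is always a pair of adjacent violinists, so that a reachable final
   state has exactly one double gap.

   If the left end of the support moves only once, every move must have fired
   the leftmost pair of the remaining full block, since any other choice leaves
   a prefix 10...1011, which can only be resolved by extending the support to
   the left; this gives the extreme cases, the other one by reflection.

   Conversely, all the listed states are reached by induction on the number of
   violinists: after firing the leftmost pair, a clusteron with one violinist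
   fewer evolves almost undisturbed to the right of a lone violinist, who
   eventually becomes adjacent to it; firing this last pair moves the support
   one room further to the left and keeps the index of the double gap. This
   construction and its reflection cover every case but one with four
   violinists. *)
Require Import Defs.
From mathcomp Require Import zify.

Set Implicit Arguments.
Unset Strict Implicit.
Unset Printing Implicit Defensive.

Import Order.TTheory GRing.Theory Num.Theory.

Local Open Scope ring_scope.

(** * Occupancy configurations and their moves *)

Definition config := int -> bool.

(* Rooms [p] and [q] are the empty ends of a block of occupied rooms; since
   every room strictly between them is occupied, the result of firing the pair
   [i], [i + 1] on [p, q] does not depend on [P]. *)
Definition fire (P : config) (p i q : int) : config := fun j =>
  (p <= j <= q) && (j != i) && (j != i + 1) || P j && ~~ (p <= j <= q).

Definition step (P Q : config) : Prop :=
  exists p i q : int,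
    [/\ p < i /\ i + 1 < q, ~~ P p, ~~ P q,
        forall j, p < j < q -> P j & Q =1 fire P p i q].

(** Transitive closure up to pointwise equality, since configurations are functions and no
    extensionality is assumed. *)
Inductive steps (P Q : config) : Prop :=
| steps_refl of P =1 Q
| steps_step Q' of steps P Q' & step Q' Q.

Lemma step_eqr P Q Q' : step P Q -> Q =1 Q' -> step P Q'.
Proof.
move=> [p [i [q [piq Pp Pq Pj QE]]]] QQ'.
by exists p, i, q; split=> // j; rewrite -QQ' QE.
Qed.

Lemma step_eql P P' Q : step P Q -> P =1 P' -> step P' Q.
Proof.
move=> [p [i [q [piq Pp Pq Pj QE]]]] PP'.
exists p, i, q; split=> //; rewrite -?PP' // => j; first by rewrite -PP'; apply: Pj.
by rewrite QE /fire PP'.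
Qed.

Lemma steps_eqr P Q Q' : steps P Q -> Q =1 Q' -> steps P Q'.
Proof.
case=> [PQ|R PR RQ] QQ'; first by apply: steps_refl => j; rewrite PQ QQ'.
exact: steps_step PR (step_eqr RQ QQ').
Qed.

Lemma steps_trans P Q R : steps P Q -> steps Q R -> steps P R.
Proof.
move=> PQ; elim=> [S QS|S S' _ PS' S'S]; first exact: steps_eqr PQ QS.
exact: steps_step PS' S'S.
Qed.

Lemma step1 P Q : step P Q -> steps P Q.
Proof. by apply: steps_step; apply: steps_refl. Qed.

Lemma steps_eql P P' Q : P =1 P' -> steps P Q -> steps P' Q.
Proof. by move=> PP'; apply: steps_trans; apply: steps_refl => j; rewrite PP'. Qed.

Definition mirror (P : config) : config := fun j => P (- j).

Lemma step_mirror P Q : step P Q -> step (mirror P) (mirror Q).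
Proof.
move=> [p [i [q [piq Pp Pq Pj QE]]]]; exists (- q), (- (i + 1)), (- p).
rewrite /mirror !opprK; split=> // [|j pjq|j]; [lia|by apply: Pj; lia|].
rewrite QE /fire; lia.
Qed.

Lemma steps_mirror P Q : steps P Q -> steps (mirror P) (mirror Q).
Proof.
elim=> [R PR|R R' _ IH /step_mirror RR']; first by apply: steps_refl => j; apply: PR.
exact: steps_step IH RR'.
Qed.

Definition block (m : int) (n : nat) : config := fun j => m <= j < m + n%:Z.

Lemma mirror_block m n : mirror (block m n) =1 block (1 - m - n%:Z) n.
Proof. by move=> j; rewrite /mirror /block; lia. Qed.

(* The configuration with shadow [F n r] and leftmost violinist in room [k]:
   even offsets before the double gap, odd offsets after it. *)
Definition gapped (n r : nat) (k : int) : config := fun j =>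
  (k <= j <= k + 2 * r%:Z - 2) && (2 %| j - k)%Z
  || (k + 2 * r%:Z + 1 <= j <= k + 2 * n%:Z - 1) && ~~ (2 %| j - k)%Z.

Lemma mirror_gapped n r k : (1 <= r < n)%N ->
  mirror (gapped n r k) =1 gapped n (n - r) (1 - k - 2 * n%:Z).
Proof. by move=> rn j; rewrite /mirror /gapped; lia. Qed.

(** * Reaching the gapped configurations *)

Definition add_room (e : int) (P : config) : config := fun j => (j == e) || P j.

(* A violinist to the left of [P] never obstructs a run of [P]: when a move of
   the run needs the room [e], the violinist of [P] goes to [e - 1] instead. *)
Lemma steps_add_room P Q e : steps P Q -> (forall j, j <= e -> ~~ P j) ->
  exists2 e', steps (add_room e P) (add_room e' Q) &
    [/\ e' <= e, forall j, j <= e' -> ~~ Q j & e' = e \/ Q (e' + 1)].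
Proof.
move=> PQ Pe; elim: PQ => [R PR|R R' _ [e1 st [le1 Re1 e1P]] RR'].
  exists e; first by apply: steps_refl => j; rewrite /add_room PR.
  by split=> [//|j /Pe|]; [rewrite PR|left].
have [p [i [q [piq Rp Rq Rj RE]]]] := RR'.
have pe1 : e1 <= p.
  rewrite leNgt; apply/negP=> pe1.
  by have /negP[] := Re1 (p + 1) ltac:(lia); apply: Rj; lia.
have [pE|pe] := eqVneq p e1.
  exists (e1 - 1); last first.
    split=> [|j je1|]; first lia.
      by rewrite RE /fire; have := Re1 j ltac:(lia); lia.
    by right; rewrite RE /fire; lia.
  apply: steps_step st _; exists (e1 - 1), i, q; rewrite /add_room.
  split=> [|||j jq|j]; first lia.
  - by have := Re1 (e1 - 1) ltac:(lia); lia.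
  - lia.
  - have [->|/Rj->] : j = e1 \/ p < j < q by lia.
      by rewrite eqxx.
    by rewrite orbT.
  - rewrite RE /fire; have := Re1 (e1 - 1) ltac:(lia).
    by have [->|] := eqVneq j (e1 - 1); lia.
exists e1; last first.
  split=> [//|j je1|]; first by rewrite RE /fire; have := Re1 j ltac:(lia); lia.
  case: e1P => [|Re1']; [by left|right; rewrite RE /fire].
  have : e1 + 1 != p by apply: contraNneq Rp => <-.
  lia.
apply: steps_step st _; exists p, i, q; rewrite /add_room.
split=> [|||j jq|j]; [lia|lia|lia|by rewrite Rj ?orbT|].
by rewrite RE /fire; lia.
Qed.

(* The state with shadow 11 followed by single gaps relaxes by pushing the
   pair 11 and the double gap left behind it to the right. *)
Lemma steps_slide n r k : (1 <= r < n)%N ->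
  steps (add_room (k - 1) (gapped n r k)) (gapped n.+1 r (k - 2)).
Proof.
move=> rn; pose T (t : nat) : config := fun j =>
  [|| (k - 2 <= j <= k + 2 * t%:Z - 4) && (2 %| j - k)%Z,
      j == k + 2 * t%:Z - 1,
      (k + 2 * t%:Z <= j <= k + 2 * r%:Z - 2) && (2 %| j - k)%Z |
      (k + 2 * r%:Z + 1 <= j <= k + 2 * n%:Z - 1) && ~~ (2 %| j - k)%Z].
suff Ts t : (t <= r)%N -> steps (T 0) (T t).
  apply: steps_eql (steps_eqr (Ts r (leqnn r)) _) => j.
  - by rewrite /T /add_room /gapped; lia.
  - by rewrite /T /gapped; lia.
elim: t => [_|t IH tr]; first exact: steps_refl.
apply: steps_step (IH (ltnW tr)) _.
exists (k + 2 * t%:Z - 2), (k + 2 * t%:Z - 1), (k + 2 * t%:Z + 1).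
by split=> [|||j jq|j]; rewrite ?/fire ?/T; lia.
Qed.

(** Firing the leftmost pair leaves a lone violinist in room [m - 1] and a block of [n] starting in
    room [m + 2], which then runs as in the hypothesis. If [L = 1], the lone violinist ends one gap
    before the gapped configuration and raises [r] by one; otherwise the two become adjacent and
    [steps_slide] keeps [r]. *)
Lemma block_add_room m n (L r : nat) : (1 <= L)%N -> (1 <= r < n)%N ->
  steps (block (m + 2) n) (gapped n r (m + 2 - L%:Z)) ->
  (2 <= L)%N \/ r = n.-1 ->
  steps (block m n.+1) (gapped n.+1 (if L == 1%N then r.+1 else r) (m - L%:Z)).
Proof.
move=> L1 rn st Lr; have [|e] := steps_add_room (e := m - 1) st.
  by move=> j; rewrite /block; lia.
move=> ste [le1 ge eP].
have first : step (block m n.+1) (add_room (m - 1) (block (m + 2) n)).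
  by exists (m - 1), m, (m + n.+1%:Z); split=> [|||j|j];
    rewrite ?/fire ?/add_room /block; lia.
apply: steps_trans (step1 first) _.
have kE : gapped n r (m + 2 - L%:Z) (m + 2 - L%:Z) by rewrite /gapped; lia.
have ek : e < m + 2 - L%:Z.
  by rewrite ltNge; apply/negP => /ge; rewrite kE.
have ek' : e = m - 1 \/ m + 2 - L%:Z <= e + 1.
  by case: eP => [->|]; [left|rewrite /gapped; right; lia].
have [L1'|L2] := eqVneq L 1%N.
  have eE : e = m - 1 by lia.
  apply: steps_eqr ste _ => j; rewrite eE /add_room /gapped; lia.
have eE : e = m + 2 - L%:Z - 1 by lia.
rewrite eE in ste; apply: steps_trans ste _.
by apply: steps_eqr (steps_slide _ rn) _ => j; congr gapped; lia.
Qed.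

(* [L] counts the violinists' exits through the left end. *)
Definition attainable (n L r : nat) : bool :=
  (1 <= r < n)%N &&
  [|| (L == 1%N) && (r == n.-1), (L == n.-1) && (r == 1%N) |
      (2 <= L <= n - 2)%N].

(** The parameters for [n.+1] violinists that [block_add_room] yields from attainable ones for
    [n]. *)
Definition extendable (n L r : nat) : bool :=
  attainable n L r && (2 <= L)%N || (L == 1%N) && (r == n).

(** Reflection turns [L], [r] into [n.+1 - L], [n.+1 - r]. The excluded case is its own reflection
    and is not extendable. *)
Lemma attainable_mirror_extendable n L r : (2 <= n)%N -> attainable n.+1 L r ->
  ~~ [&& n == 3%N, L == 2%N & r == 2%N] ->
  extendable n L r \/ extendable n (n.+1 - L) (n.+1 - r).
Proof.
rewrite /extendable /attainable => n2.
case/andP=> rn /or3P[/andP[/eqP-> /eqP->]|/andP[/eqP-> /eqP->]|Ln] nspec.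
- by left; rewrite /= !eqxx orbT.
- by right; rewrite subSnn subn1 /=; lia.
have [rE|rn'] := eqVneq r n.
  rewrite rE subSn // subnn; right; lia.
have [LE|Ln'] := eqVneq L n.-1; last by left; lia.
have -> : (n.+1 - L = 2)%N by lia.
have [r1|r1] := eqVneq r 1%N; first by left; lia.
by right; lia.
Qed.

Lemma steps_block_extend n :
  (forall m L r, attainable n L r ->
    steps (block m n) (gapped n r (m - L%:Z))) ->
  forall m L r, (2 <= n)%N ->
  extendable n L r -> steps (block m n.+1) (gapped n.+1 r (m - L%:Z)).
Proof.
move=> IH m L r n2 /orP[/andP[Lr L2]|/andP[/eqP-> /eqP->]].
  have := @block_add_room m n L r ltac:(lia) ltac:(rewrite /attainable in Lr; lia).
  by case: eqP => [|_]; [lia|apply; [exact: IH|left]].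
have := @block_add_room m n 1 n.-1 ltac:(lia) ltac:(lia).
rewrite eqxx prednK; last lia.
by apply; [apply: IH; rewrite /attainable; lia|right].
Qed.

Lemma steps_block_gapped n m L r : (2 <= n)%N -> attainable n L r ->
  steps (block m n) (gapped n r (m - L%:Z)).
Proof.
elim: n m L r => [//|n IH] m L r n2 Lr.
have [n1|n1] := eqVneq n 1%N.
  have -> : L = 1%N by move: Lr; rewrite /attainable; lia.
  have -> : r = 1%N by move: Lr; rewrite /attainable; lia.
  apply: step1; exists (m - 1), m, (m + 2).
  by split=> [|||j|j]; rewrite ?/fire /block ?/gapped; lia.
have n2' : (2 <= n)%N by lia.
have ext := @steps_block_extend n (fun m L r => IH m L r n2').
have [spec|nspec] := boolP [&& n == 3%N, L == 2%N & r == 2%N].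
  (* An explicit run: fire the middle pair, then the left pair, the right pair and the new middle
     pair. *)
  case/and3P: spec => /eqP-> /eqP-> /eqP->.
  pose S (x y z t : int) : config := fun j =>
    [|| j == m + x, j == m + y, j == m + z | j == m + t].
  clear IH ext n2 n2' Lr n1; have S1 : step (block m 4) (S (-1) 0 3 4).
    by exists (m - 1), (m + 1), (m + 4); split=> [|||j|j]; rewrite ?/fire /block ?/S; lia.
  have S2 : step (S (-1) 0 3 4) (S (-2) 1 3 4).
    by exists (m - 2), (m - 1), (m + 1); split=> [|||j|j]; rewrite ?/fire /S; lia.
  have S3 : step (S (-2) 1 3 4) (S (-2) 1 2 5).
    by exists (m + 2), (m + 3), (m + 5); split=> [|||j|j]; rewrite ?/fire /S; lia.
  have S4 : step (S (-2) 1 2 5) (gapped 4 2 (m - 2)).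
    by exists m, (m + 1), (m + 3); split=> [|||j|j]; rewrite ?/fire ?/gapped /S; lia.
  exact: steps_step (steps_step (steps_step (step1 S1) S2) S3) S4.
have rn : (1 <= r < n.+1)%N by move: Lr; rewrite /attainable; lia.
have [Lr'|Lr'] := attainable_mirror_extendable n2' Lr nspec.
  exact: ext.
have /steps_mirror st := ext (1 - m - n.+1%:Z) _ _ n2' Lr'.
apply: steps_eql (steps_eqr st _) => j.
  by rewrite mirror_block; congr block; lia.
rewrite mirror_gapped; last lia.
move: Lr; rewrite /attainable => Lr; congr gapped; lia.
Qed.

(** * Shape of the final configurations *)

Lemma step_leftmost (P Q : config) : (exists2 k, P k & forall j, P j -> k <= j) ->
  step P Q -> exists2 k, Q k & forall j, Q j -> k <= j.
Proof.
move=> [k Pk kP] [p [i [q [piq Pp Pq Pj QE]]]].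
have pk : p != k by apply: contraNneq Pp => ->.
have [ltpk|lekp] := ltP p k.
  by exists p => [|j]; rewrite QE /fire; [lia|have := kP j; lia].
by exists k => [|j]; rewrite QE /fire; [rewrite Pk; lia|have := kP j; lia].
Qed.

Lemma steps_block_leftmost m n (P : config) : (0 < n)%N -> steps (block m n) P ->
  exists2 k, P k & forall j, P j -> k <= j.
Proof.
move=> n0; elim=> [Q PQ|Q Q' _ IH]; last exact: step_leftmost IH.
by exists m => [|j]; rewrite -PQ /block; lia.
Qed.

Lemma steps_block_rightmost m n (P : config) : (0 < n)%N -> steps (block m n) P ->
  exists2 k, P k & forall j, P j -> j <= k.
Proof.
move=> n0 /steps_mirror /(steps_eql (mirror_block m n)).
case/(steps_block_leftmost n0) => k Pk kP; exists (- k) => // j Pj.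
by have := kP (- j); rewrite /mirror opprK Pj; lia.
Qed.

Definition double_gap (P : config) (s : int) : Prop :=
  [/\ ~~ P s, ~~ P (s + 1), exists2 x, x < s & P x & exists2 y, s < y & P y].

(** Three consecutive empty rooms inside the support are excluded as well: they give double gaps at
    adjacent positions, with no room for a pair between. *)
Definition separated (P : config) : Prop :=
  forall s t, s < t -> double_gap P s -> double_gap P t ->
  exists2 u, s + 1 < u /\ u + 1 < t & P u && P (u + 1).

(* Double gaps outside the fired block are unchanged; on either side of the new
   one, the end of the block either extends a run of occupied rooms or was part
   of an old double gap. *)
Lemma step_separated P Q : separated P -> step P Q -> separated Q.
Proof.
move=> sP [p [i [q [[pi iq] Pp Pq Pj QE]]]] s t st.
have Pi : P i by apply: Pj; clear - pi iq; lia.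
have Qp : Q p by rewrite QE /fire; clear - pi iq; lia.
have Qq : Q q by rewrite QE /fire; clear - pi iq; lia.
have out j : j < p \/ q < j -> Q j = P j by rewrite QE /fire; clear; lia.
have dgQ s' : double_gap Q s' -> s' = i \/ double_gap P s' /\ (s' + 1 < p \/ q < s').
  move=> [Qs Qs1 [x xs Qx] [y sy Qy]].
  have [/eqP->|nsi] := boolP (s' == i); [by left|right].
  have so : s' + 1 < p \/ q < s'.
    by move: Qs Qs1; rewrite !QE /fire; clear - nsi pi iq; lia.
  split=> //; split.
  - by rewrite -out //; clear - so; lia.
  - by rewrite -out //; clear - so; lia.
  - case: so => so; [exists x|exists i] => //; last by clear - so iq; lia.
    by rewrite -out //; clear - so xs; lia.
  - case: so => so; [exists i|exists y] => //; first by clear - so pi; lia.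
    by rewrite -out //; clear - so sy; lia.
have left s' : s' + 1 < p -> double_gap P s' ->
    exists2 u, s' + 1 < u /\ u < p & Q u && Q (u + 1).
  move=> sp ds; have [Pp1|Pp1] := boolP (P (p - 1)).
    have ps : p - 1 != s' + 1 by case: ds => _ Ps _ _; apply: contraNneq Ps => <-.
    exists (p - 1); first by clear - sp ps; lia.
    by rewrite subrK out ?Pp1 //; clear; lia.
  have [||u us Pu] := sP s' (p - 1) _ ds; first by clear - sp; lia.
    split=> //; first by rewrite subrK.
      by case: ds => _ _ [x xs Px] _; exists x => //; clear - xs sp; lia.
    by exists i => //; clear - pi; lia.
  exists u; first by clear - us; lia.
  by rewrite !out //; clear - us; lia.
have right t' : q < t' -> double_gap P t' ->
    exists2 u, q <= u /\ u + 1 < t' & Q u && Q (u + 1).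
  move=> qt dt; have [Pq1|Pq1] := boolP (P (q + 1)).
    have qt1 : q + 1 != t' by case: dt => Pt _ _ _; apply: contraNneq Pt => <-.
    exists q; first by clear - qt qt1; lia.
    by rewrite (out (q + 1)) ?Pq1 ?Qq //; clear; lia.
  have [||u us Pu] := sP q t' _ _ dt => //.
    split=> //; first by exists i => //; clear - iq; lia.
    by case: dt => _ _ _ [y ty Py]; exists y => //; clear - ty qt; lia.
  exists u; first by clear - us; lia.
  by rewrite !out //; clear - us; lia.
move=> /dgQ[si|[ds so]] /dgQ[ti|[dt to]].
- by clear - st si ti; lia.
- have [|u us Qu] := right t _ dt; first by clear - si to st pi; lia.
  by exists u => //; clear - us si iq; lia.
- have [|u us Qu] := left s _ ds; first by clear - ti so st iq; lia.
  by exists u => //; clear - us ti pi; lia.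
(* Old double gaps on opposite sides of the fired block are separated by the pair found on its left;
   on the same side, the old pair is untouched. *)
- have [[sp tq]|both] : (s + 1 < p /\ q < t) \/ (t + 1 < p \/ q < s).
    by clear - so to; lia.
  + have [u us Qu] := left s sp ds.
    by exists u => //; clear - us tq pi iq; lia.
  have [u us Pu] := sP s t st ds dt.
  by exists u => //; rewrite !out //; clear - us both; lia.
Qed.

Lemma steps_block_separated m n P : steps (block m n) P -> separated P.
Proof.
elim=> [Q PQ|Q Q' _ IH]; last exact: step_separated IH.
by move=> s t _ [Ps _ [x xs Px] [y sy Py]]; move: Ps Px Py; rewrite -!PQ /block; lia.
Qed.

Definition isolated (P : config) : Prop := forall j, ~~ (P j && P (j + 1)).

(** Isolation empties the room after an occupied one, and the gap hypothesis fills the room after an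
    empty one. *)
Lemma alternating (P : config) k t : isolated P ->
  (forall s, k < s < t -> ~~ P s -> P (s + 1)) -> P k ->
  forall j, k <= j <= t -> P j = (2 %| j - k)%Z.
Proof.
move=> iso ngap Pk j kj.
have [d dE dt] : exists2 d : nat, j = k + d%:Z & k + d%:Z <= t.
  by exists `|j - k|%N; lia.
rewrite {j kj}dE; elim: d dt => [_|d IH dt]; first by rewrite addr0 Pk; lia.
have Pd := IH ltac:(lia).
have -> : k + d.+1%:Z = k + d%:Z + 1 by lia.
have [Pt|Pf] := boolP (P (k + d%:Z)).
  by have := iso (k + d%:Z); rewrite Pt /=; move: Pd; lia.
have kd : d != 0%N by apply: contraNneq Pf => ->; rewrite addr0.
by rewrite ngap //; move: Pd; lia.
Qed.

Lemma eq_gapped (P : config) n r k : (1 <= r < n)%N ->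
  (forall j, P j -> k <= j <= k + 2 * n%:Z - 1) ->
  (forall j, k <= j <= k + 2 * r%:Z - 1 -> P j = (2 %| j - k)%Z) ->
  ~~ P (k + 2 * r%:Z) ->
  (forall j, k + 2 * r%:Z + 1 <= j <= k + 2 * n%:Z - 1 ->
    P j = (2 %| j - (k + 2 * r%:Z + 1))%Z) ->
  P =1 gapped n r k.
Proof.
move=> rn Pkn Pl /negPf Pm Pr j; rewrite /gapped.
have [jout|jin] := boolP (k <= j <= k + 2 * n%:Z - 1); last first.
  have -> : P j = false by apply/negP=> /Pkn; rewrite (negPf jin).
  clear - jin rn; lia.
have [jl|jl] := leP j (k + 2 * r%:Z - 1).
  have {}Pl := Pl j ltac:(clear - jout jl; lia).
  by rewrite Pl; clear - jout jl; lia.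
have [->|jr] := eqVneq j (k + 2 * r%:Z); first by rewrite Pm; clear; lia.
have jr' : k + 2 * r%:Z + 1 <= j by clear - jl jr; lia.
have {}Pr := Pr j ltac:(clear - jout jr'; lia).
by rewrite Pr; clear - jout jr'; lia.
Qed.

(** The last move leaves a double gap; a second one would force an adjacent pair between them. Hence
    occupancy alternates on both sides of it. The number [n'] of violinists is identified later by
    counting. *)
Lemma steps_block_isolated_gapped m n P : (2 <= n)%N -> steps (block m n) P ->
  isolated P -> exists n' r k, (1 <= r < n')%N /\ P =1 gapped n' r k.
Proof.
move=> n2 st iso.
have [k Pk kP] := steps_block_leftmost (ltnW n2) st.
have [R PR RP] := steps_block_rightmost (ltnW n2) st.
have sep := steps_block_separated st.
have [i di] : exists i, double_gap P i.
  case: st => [PE|Q _ [p [i [q [[pi iq] _ _ _ QE]]]]].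
    by have := iso m; rewrite -!PE /block; clear - n2; lia.
  have [Qp Qq Qi Qi1] : [/\ P p, P q, ~~ P i & ~~ P (i + 1)].
    by split; rewrite QE /fire; clear - pi iq; lia.
  exists i; split=> //; first by exists p.
  by exists q => //; clear - iq; lia.
have uniq_dg s : double_gap P s -> s = i.
  move=> ds; apply/eqP; case: ltgtP => // si.
    by have [u _ /(negP (iso u))] := sep _ _ si ds di.
  by have [u _ /(negP (iso u))] := sep _ _ si di ds.
have [Pi Pi1 [x xi Px] [y iy Py]] := di.
have ki : k < i := le_lt_trans (kP x Px) xi.
have iR : i + 1 < R.
  have := RP y Py; have : y != i + 1 by apply: contraNneq Pi1 => <-.
  by clear - iy; lia.
have gap s : k < s -> s < R -> s != i -> ~~ P s -> P (s + 1).
  move=> ks sR si Ps; apply: contraT => Ps1; case/eqP: si; apply: uniq_dg.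
  by split=> //; [exists k|exists R].
have Pi2 : P (i + 2).
  have := gap (i + 1); rewrite -addrA; apply=> //; clear - ki; lia.
have Pl : forall j, k <= j <= i -> P j = (2 %| j - k)%Z.
  apply: alternating => // s /andP[ks si]; apply: gap => //.
    by clear - si iR; lia.
  by clear - si; lia.
have Pr : forall j, i + 2 <= j <= R -> P j = (2 %| j - (i + 2))%Z.
  apply: alternating => // s /andP[ilts sR]; apply: gap => //.
    by clear - ilts ki; lia.
  by clear - ilts; lia.
have i_odd : ~~ (2 %| i - k)%Z by rewrite -Pl // lexx ltW.
have R_even : (2 %| R - (i + 2))%Z by rewrite -Pr // lexx; clear - iR; lia.
(* [r] counts the violinists in rooms [k], [k + 2], ..., [i - 1]. *)
have [r rE] : exists r : nat, i = k + 2 * r%:Z - 1.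
  by exists `|((i - k + 1) %/ 2)%Z|%N; clear - ki i_odd; lia.
have [n' nE] : exists n' : nat, R = k + 2 * n'%:Z - 1.
  by exists `|((R - k + 1) %/ 2)%Z|%N; clear - ki iR i_odd R_even; lia.
exists n', r, k; have rn' : (1 <= r < n')%N by clear - rE nE ki iR; lia.
split=> //; apply: eq_gapped => // [j Pj|j|| j].
- by rewrite kP // -nE RP.
- by rewrite -rE; apply: Pl.
- by rewrite (_ : k + 2 * r%:Z = i + 1) //; clear - rE; lia.
- rewrite -nE (_ : k + 2 * r%:Z + 1 = i + 2); first exact: Pr.
  by clear - rE; lia.
Qed.

(** * Range of the leftmost room *)

(* The state (10)^t 0 1^(n-t), obtained by firing the leftmost pair [t] times. *)
Definition peeled (m : int) (n t : nat) : config := fun j =>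
  (m - 1 <= j <= m + 2 * t%:Z - 3) && (2 %| j - m + 1)%Z
  || (m + 2 * t%:Z <= j <= m + n%:Z + t%:Z - 1).

(* The configuration starts in room [m - 1] with a prefix (10)^* 11: only a
   second exit to the left can resolve such a prefix. *)
Definition jammed (m : int) (P : config) : Prop :=
  (forall j, j <= m - 2 -> ~~ P j) /\
  exists t, [/\ m - 1 <= t, (2 %| t - m + 1)%Z, P t && P (t + 1) &
    forall j, m - 1 <= j <= t -> P j = (2 %| j - m + 1)%Z].

(** If the left end [p] of the fired block lies beyond the prefix, the prefix survives. If [p] lies
    inside it, [p] is an empty room followed by two occupied ones, so [p = t - 1], and filling it
    makes [p - 1], [p] the new pair 11. *)
Lemma step_jammed m P Q : jammed m P -> step P Q ->
  (exists2 j, j <= m - 2 & Q j) \/ jammed m Q.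
Proof.
move=> [Pm [t [mt t_even /andP[Pt Pt1] pat]]] [p [i [q [[pi iq] Pp Pq Pj QE]]]].
have Qp : Q p by rewrite QE /fire; clear - pi iq; lia.
have [pm|mp] := leP p (m - 2); first by left; exists p.
have out j : j < p -> Q j = P j by rewrite QE /fire; clear; lia.
right; split=> [j jm|].
  by rewrite out; [apply: Pm|clear - jm mp; lia].
have npt : p != t by apply: contraNneq Pp => ->.
have npt1 : p != t + 1 by apply: contraNneq Pp => ->.
have [tp|pt] : t + 1 < p \/ p < t by clear - npt npt1; lia.
  exists t; split=> // [|j jt]; first by rewrite !out ?Pt //; clear - tp; lia.
  by rewrite out ?pat //; clear - jt tp; lia.
have p_odd : ~~ (2 %| p - m + 1)%Z.
  by rewrite -pat //; clear - mp pt; lia.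
have pE : p = t - 1.
  have [//|pt2] := eqVneq p (t - 1).
  have := pat (p + 2) ltac:(clear - pt pt2 mp; lia).
  rewrite Pj; last by clear - pi iq; lia.
  by clear - p_odd; lia.
have mp' : m <= p by clear - mp p_odd; lia.
exists (p - 1); split=> [|||j jt]; [clear - mp'; lia|clear - p_odd; lia| |].
- rewrite subrK Qp andbT out ?pat; [clear - p_odd; lia| |clear; lia].
  by clear - mp' pE; lia.
- by rewrite out ?pat //; clear - jt pE; lia.
Qed.

(** Only the full block can fire, so [p] and [q] are its neighbours. Firing a pair other than the
    leftmost keeps [p + 1] occupied next to the newly filled [p], which completes a jammed
    prefix. *)
Lemma step_peeled m n t P Q : (2 <= n)%N -> P =1 peeled m n t -> step P Q ->
  jammed m Q \/ (t.+1 < n)%N /\ Q =1 peeled m n t.+1.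
Proof.
move=> n2 PE [p [i [q [[pi iq] Pp Pq Pj QE]]]].
have Pp1 := Pj (p + 1) ltac:(lia); have Pp2 := Pj (p + 2) ltac:(lia).
have Pq1 := Pj (q - 1) ltac:(lia).
have pE : p = m + 2 * t%:Z - 1.
  by move: Pp Pp1 Pp2; rewrite !PE /peeled; lia.
have qE : q = m + n%:Z + t%:Z.
  by move: Pq Pq1; rewrite !PE /peeled; lia.
have {}QE j : Q j = fire (peeled m n t) p i q j by rewrite QE /fire PE.
have [ip|ip] := eqVneq i (p + 1).
  right; split=> [|j]; first lia.
  by rewrite QE /fire /peeled; lia.
clear Pp Pq Pp1 Pp2 Pq1.
left; split=> [j jm|]; first by rewrite QE /fire /peeled; lia.
by exists p; split=> [|||j jp]; rewrite ?QE /fire /peeled; lia.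
Qed.

Lemma steps_block_left m n P : (2 <= n)%N -> steps (block m n) P ->
  [\/ exists2 j, j <= m - 2 & P j, jammed m P |
      exists2 t, (t < n)%N & P =1 peeled m n t].
Proof.
move=> n2; elim=> [Q PQ|Q Q' _ IH st].
  apply: Or33; exists 0%N => [|j]; first lia.
  by rewrite -PQ /block /peeled; lia.
case: IH => [[j jm Qj]|jam|[t tn QE]].
(* A second exit is permanent: either [p] is at least as far left as [j], or room [j] stays
   occupied. *)
- have [p [i [q [[pi iq] Pp Pq Pj QE]]]] := st.
  have [pj|jp] := leP p j; apply: Or31.
    by exists p; rewrite ?QE /fire; lia.
  by exists j; rewrite ?QE /fire ?Qj; lia.
- by case: (step_jammed jam st) => ?; [apply: Or31|apply: Or32].
- case: (step_peeled n2 QE st) => [?|[tn' QE']]; first exact: Or32.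
  by apply: Or33; exists t.+1.
Qed.

(** A gapped configuration has no adjacent pair, so it is not jammed; without a second exit it is
    [peeled] with [t = n.-1], whose double gap precedes the last violinist. *)
Lemma steps_block_gapped_left m n r k P : (1 <= r < n)%N ->
  steps (block m n) P -> P =1 gapped n r k ->
  k <= m - 2 \/ k = m - 1 /\ r = n.-1.
Proof.
move=> rn st PE; have n2 : (2 <= n)%N by lia.
case: (steps_block_left n2 st) => [[j jm]|[_ [t [_ _ + _]]]|[t tn QE]].
- by rewrite PE /gapped; left; lia.
- by rewrite !PE /gapped; lia.
have PQ j : gapped n r k j = peeled m n t j by rewrite -PE QE.
have {PE QE st} tE : t = n.-1.
  have := PQ (m + 2 * t%:Z); have := PQ (m + 2 * t%:Z + 1).
  by rewrite /gapped /peeled; lia.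
have mk : m - 1 <= k.
  have : peeled m n t k by rewrite -PQ /gapped; clear - rn; lia.
  by rewrite /peeled tE; clear - n2; lia.
have km : k <= m - 1.
  have : gapped n r k (m - 1) by rewrite PQ /peeled tE; clear - n2; lia.
  by rewrite /gapped; clear; lia.
have kE : k = m - 1 by apply/eqP; rewrite eq_le km mk.
right; split=> //.
(* The last violinist but one sits at an even offset from [k], hence before the double gap. *)
have : gapped n r k (m + 2 * t%:Z - 3).
  by rewrite PQ /peeled tE; clear - n2; lia.
by rewrite /gapped kE tE; clear - rn; lia.
Qed.

Lemma steps_block_gapped_range m n r k P : (1 <= r < n)%N ->
  steps (block m n) P -> P =1 gapped n r k ->
  (k <= m - 2 \/ k = m - 1 /\ r = n.-1) /\
  (m - n%:Z + 2 <= k \/ k = m - n%:Z + 1 /\ r = 1%N).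
Proof.
move=> rn st PE; split; first exact: steps_block_gapped_left st PE.
have {}st := steps_eql (mirror_block m n) (steps_mirror st).
have {}PE : mirror P =1 gapped n (n - r) (1 - k - 2 * n%:Z).
  by move=> j; rewrite -mirror_gapped // /mirror PE.
have rn' : (1 <= n - r < n)%N by lia.
have := steps_block_gapped_left rn' st PE; lia.
Qed.

(** * States and configurations *)

Lemma occupied_eq (a b : state) : at_most_one a -> at_most_one b ->
  occupied a =1 occupied b -> a = b.
Proof.
move=> a1 b1 ab; apply/fsfunP => j.
by have := ab j; have := a1 j; have := b1 j; rewrite /occupied; lia.
Qed.

Lemma mem_finsupp_occupied (a : state) j : (j \in finsupp a) = occupied a j.
Proof. by rewrite mem_finsupp /occupied lt0n. Qed.

(** All rooms between the two nearest empty ones are occupied, once each, so the move acts on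
    occupancy as [fire], and both violinists land in empty rooms. *)
Lemma move_step (a b : state) : at_most_one a -> move a b ->
  [/\ step (occupied a) (occupied b), at_most_one b &
      #|` finsupp b| = #|` finsupp a|].
Proof.
move=> a1 [i [ai ai1 [p [q [[pi ap pj] [iq aq qj] bE]]]]].
have apq j : p < j < q -> occupied a j.
  move=> jpq; have [||ji] := ltgtP j i; last by rewrite ji.
    by move=> ji; apply: pj; lia.
  move=> ij; have [->//|ji1] := eqVneq j (i + 1).
  by apply: qj; lia.
have ajp j : j = p -> a j = 0%N by move=> ->; move: ap; rewrite /occupied; lia.
have ajq j : j = q -> a j = 0%N by move=> ->; move: aq; rewrite /occupied; lia.
have b1 : at_most_one b.
  move=> j; rewrite bE; move: (a1 j) (ajp j) (ajq j); clear - pi iq; lia.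
have bocc j : occupied b j = fire (occupied a) p i q j.
  rewrite /fire; have [jpq|jpq] := boolP (p < j < q).
    by move: (apq _ jpq) (a1 j); rewrite /occupied bE; lia.
  have [->|jp] := eqVneq j p.
    by rewrite /occupied bE (ajp p) //; clear - pi iq; lia.
  have [->|jq] := eqVneq j q.
    by rewrite /occupied bE (ajq q) //; clear - pi iq; lia.
  by rewrite /occupied bE; clear - jpq jp jq pi iq; lia.
split=> //; first by exists p, i, q.
have -> : finsupp b = (p |` (q |` ((finsupp a `\ i) `\ (i + 1)%R)))%fset.
  apply/fsetP=> j; rewrite !inE !mem_finsupp_occupied bocc /fire.
  by have := apq j; lia.
rewrite !cardfsU1 !inE (cardfsD1 i (finsupp a)) (cardfsD1 (i + 1) (finsupp a `\ i)%fset).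
have pq : (p == q) = false by lia.
have ii1 : (i + 1 == i) = false by lia.
by rewrite !inE !mem_finsupp_occupied ai ai1 (negPf ap) (negPf aq) pq ii1 !andbF.
Qed.

Lemma step_move (a : state) Q : at_most_one a -> step (occupied a) Q ->
  exists b : state, [/\ move a b, at_most_one b & occupied b =1 Q].
Proof.
move=> a1 [p [i [q [[pi iq] ap aq apq QE]]]].
pose b : state := [fsfun j in (p |` (q |` finsupp a))%fset => (Q j : nat) | 0%N].
have bE j : b j = Q j.
  rewrite fsfunE !inE mem_finsupp_occupied QE /fire.
  case: ifP => // jb; have := apq j; lia.
exists b; split=> [|j|j]; last 2 first.
- by rewrite bE; case: (Q j).
- by rewrite /occupied bE; case: (Q j).
exists i; split; [apply: apq; lia|apply: apq; lia|exists p, q; split].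
- by split=> // j jp; apply: apq; lia.
- by split=> // j jp; apply: apq; lia.
move=> j; rewrite bE QE /fire; have := a1 j; have := apq j.
have [jpq|jpq] := boolP (p < j < q).
  move=> /(_ isT) + aj1; rewrite /occupied => aj.
  have -> : a j = 1%N by clear - aj aj1; lia.
  by clear - jpq; lia.
move=> _; have [->|jp] := eqVneq j p.
  move: ap; rewrite /occupied lt0n negbK => /eqP-> _.
  by clear - pi iq; lia.
have [->|jq] := eqVneq j q.
  move: aq; rewrite /occupied lt0n negbK => /eqP-> _.
  by clear - pi iq; lia.
by rewrite /occupied; clear - jp jq jpq pi iq; lia.
Qed.

Lemma reachable_steps (a b : state) : at_most_one a -> reachable a b ->
  [/\ steps (occupied a) (occupied b), at_most_one b &
      #|` finsupp b| = #|` finsupp a|].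
Proof.
move=> + ab; elim: ab => [c|c d e cd _ IH] c1; first by split=> //; apply: steps_refl.
have [st d1 cardd] := move_step c1 cd; have [sts e1 carde] := IH d1.
by split; rewrite ?carde //; apply: steps_trans (step1 st) sts.
Qed.

Lemma steps_reachable (a : state) Q : at_most_one a -> steps (occupied a) Q ->
  exists b : state, [/\ reachable a b, at_most_one b & occupied b =1 Q].
Proof.
move=> a1; elim=> [P aP|P P' _ [b [ab b1 bP]] PP'].
  by exists a; split=> //; apply: rt1n_refl.
have {}PP' : step (occupied b) P by apply: step_eql PP' _ => j; rewrite bP.
have [c [bc c1 cP]] := step_move b1 PP'.
(* [reachable] grows at the front and [steps] at the back, hence the detour through the symmetric
   form of the closure. *)
exists c; split=> //; apply/Operators_Properties.clos_rt_rt1n.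
apply: rt_trans; first exact/Operators_Properties.clos_rt1n_rt/ab.
exact: rt_step.
Qed.

Lemma flat_clusteron_le1 m n : at_most_one (flat_clusteron m n).
Proof. by move=> j; rewrite flat_clusteronE; case: (_ && _). Qed.

Lemma occupied_flat_clusteron m n : occupied (flat_clusteron m n) =1 block m n.
Proof. by move=> j; rewrite /occupied flat_clusteronE lt0b. Qed.

Lemma card_flat_clusteron m n : #|` finsupp (flat_clusteron m n)| = n.
Proof.
elim: n => [|n IH].
  apply/eqP; rewrite cardfs_eq0; apply/eqP/fsetP=> j.
  by rewrite mem_finsupp_occupied occupied_flat_clusteron inE /block; lia.
have -> : finsupp (flat_clusteron m n.+1)
    = ((m + n%:Z)%R |` finsupp (flat_clusteron m n))%fset.
  apply/fsetP=> j; rewrite !inE !mem_finsupp_occupied.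
  by rewrite !occupied_flat_clusteron /block; lia.
rewrite cardfsU1 IH mem_finsupp_occupied occupied_flat_clusteron /block; lia.
Qed.

(** The bounds on the support provide nearest empty rooms on both sides, so any adjacent pair could
    fire. *)
Lemma final_isolated (a : state) (l u : int) : at_most_one a ->
  (forall j, occupied a j -> l <= j <= u) -> final a -> isolated (occupied a).
Proof.
move=> a1 alu fin_a i; apply/negP=> /andP[ai ai1]; case: fin_a.
have exl : exists d : nat, ~~ occupied a (i - d%:Z).
  by exists (absz (i - l + 1)); apply/negP=> /alu; have := alu i ai; lia.
have exr : exists d : nat, ~~ occupied a (i + d%:Z).
  by exists (absz (u - i + 1)); apply/negP=> /alu; have := alu i ai; lia.
case: (ex_minnP exl) => dl al dlmin; case: (ex_minnP exr) => dr ar drmin.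
have dl0 : dl != 0%N by apply: contraNneq al => ->; rewrite subr0.
have dr0 : dr != 0%N by apply: contraNneq ar => ->; rewrite addr0.
have dr1 : dr != 1%N by apply: contraNneq ar => ->.
have st : step (occupied a) (fire (occupied a) (i - dl%:Z) i (i + dr%:Z)).
  exists (i - dl%:Z), i, (i + dr%:Z); split=> // [|j jlr]; first lia.
  apply: contraT => aj; have [ji|ij] := leP j i.
    have := dlmin `|i - j|%N; rewrite (_ : i - _ = j); last lia.
    by move=> /(_ aj); lia.
  have := drmin `|j - i|%N; rewrite (_ : i + _ = j); last lia.
  by move=> /(_ aj); lia.
by have [b [ab _ _]] := step_move a1 st; exists b.
Qed.

Lemma isolated_final (a : state) : isolated (occupied a) -> final a.
Proof. by move=> iso [b [i [ai ai1 _]]]; have := iso i; rewrite ai ai1. Qed.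

(** * Violinist counts, shadows and the classification *)

Lemma gapped_isolated n r k : isolated (gapped n r k).
Proof. by move=> j; rewrite /gapped; lia. Qed.

Lemma card_gapped (a : state) n r k : (1 <= r < n)%N ->
  occupied a =1 gapped n r k -> #|` finsupp a| = n.
Proof.
(* [f j] is the room of violinist [j], counted from 0; those after the double gap are shifted by
   one. *)
move=> rn aE; pose f (j : nat) : int := k + 2 * j%:Z + (r <= j)%N%:Z.
have -> : finsupp a = [fset f j | j in iota 0 n]%fset.
  apply/fsetP=> j; rewrite mem_finsupp_occupied aE /gapped /f.
  apply/idP/imfsetP => /= [jE|[x]]; last by rewrite mem_iota => xn ->; lia.
  by exists `|((j - k) %/ 2)%Z|%N; rewrite ?mem_iota /=; lia.
rewrite card_imfset /=; last by move=> x y; rewrite /f; lia.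
by rewrite undup_id ?iota_uniq // size_iota.
Qed.

(** Ones sit at even positions before the double gap and at odd ones after it. Allowing [n <= r],
    where no double gap occurs and the word is one letter shorter, lets the induction on [n] pass
    through the prefixes. *)
Lemma F_mkseq n r : (0 < n)%N -> (0 < r)%N ->
  F n r = mkseq (fun i => odd i (+) (i < 2 * r)%N) (2 * n - (n <= r))%N.
Proof.
case: n => // n _ r0; elim: n => [|n IH].
  by rewrite (_ : 2 * 1 - _ = 1)%N; last lia; rewrite /mkseq /=; congr cons; lia.
have -> : F n.+2 r = F n.+1 r ++ if n.+1 == r then [:: false; false; true]
                                 else [:: false; true].
  rewrite /F (_ : n.+2.-1 = n + 1)%N; last by rewrite addn1.
  by rewrite iotaD map_cat flatten_cat /= cats0 add1n.
rewrite IH; set g := fun i => _; case: eqP => nr.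
  rewrite (_ : 2 * n.+2 - _ = 2 * n.+1 - (n.+1 <= r)%N + 3)%N; last lia.
  rewrite /mkseq iotaD map_cat; congr cat; rewrite /= /g.
  congr [:: _; _; _]; lia.
rewrite (_ : 2 * n.+2 - _ = 2 * n.+1 - (n.+1 <= r)%N + 2)%N; last lia.
rewrite /mkseq iotaD map_cat; congr cat; rewrite /= /g.
congr [:: _; _]; lia.
Qed.

Lemma shadow_gapped (a : state) n r k : (1 <= r < n)%N ->
  (has_shadow a (F n r) /\ leftmost a k) <->
  (at_most_one a /\ occupied a =1 gapped n r k).
Proof.
move=> rn; have FE := @F_mkseq n r ltac:(lia) ltac:(lia).
have {}FE : F n r = mkseq (fun i => odd i (+) (i < 2 * r)%N) (2 * n)%N.
  by rewrite FE (_ : 2 * n - _ = 2 * n)%N //; lia.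
rewrite /has_shadow FE; split=> [[[a1 [l [u [[al la] [au ua] wE]]]] [ak ka]]|[a1 aE]].
  have lk : l = k by apply/eqP; rewrite eq_le la // ka.
  subst l; have ku := ka u au.
  have := congr1 size wE; rewrite !size_mkseq => sz.
  split=> // j; have [jout|jin] := boolP ((j < k) || (u < j)).
    have -> : occupied a j = false.
      by apply/negP => aj; have := ka j aj; have := ua j aj; lia.
    by rewrite /gapped; lia.
  have jn : (`|j - k| < 2 * n)%N by lia.
  have := congr1 (fun s => nth false s `|j - k|%N) wE.
  rewrite !nth_mkseq -?sz // (_ : k + _ = j); last lia.
  by move=> <-; rewrite /gapped; lia.
have lm : leftmost a k by split=> [|j]; rewrite aE /gapped; lia.
split=> //; split=> //; exists k, (k + 2 * n%:Z - 1); split=> //.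
  by split=> [|j]; rewrite aE /gapped; lia.
rewrite (_ : (absz _).+1 = 2 * n)%N; last lia.
apply/eq_in_map => i; rewrite mem_iota aE /gapped; lia.
Qed.

Lemma reachable_final_gapped n m (a : state) : (2 <= n)%N ->
  reachable (flat_clusteron m n) a /\ final a <->
  exists (L r : nat), [/\ attainable n L r, at_most_one a &
    occupied a =1 gapped n r (m - L%:Z)].
Proof.
move=> n2; split=> [[ra fa]|[L [r [Lr a1 aE]]]].
  have [st a1 carda] := reachable_steps (@flat_clusteron_le1 m n) ra.
  have {}st := steps_eql (@occupied_flat_clusteron m n) st.
  have [l _ la] := steps_block_leftmost (ltnW n2) st.
  have [u _ ua] := steps_block_rightmost (ltnW n2) st.
  have iso : isolated (occupied a).
    by apply: (@final_isolated a l u) => // j aj; rewrite la // ua.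
  have [n' [r [k [rn' aE]]]] := steps_block_isolated_gapped n2 st iso.
  (* Moves preserve the number of violinists. *)
  have n'E : n' = n by rewrite -(card_gapped rn' aE) carda card_flat_clusteron.
  subst n'; have [range1 range2] := steps_block_gapped_range rn' st aE.
  exists `|m - k|%N, r; split=> //; first by rewrite /attainable; lia.
  by move=> j; rewrite aE; congr gapped; lia.
split; last first.
  apply: isolated_final => j; rewrite !aE; exact: gapped_isolated.
have := steps_block_gapped m n2 Lr.
have fE j : block m n j = occupied (flat_clusteron m n) j.
  by rewrite occupied_flat_clusteron.
move=> /(steps_eql fE) /(steps_reachable (@flat_clusteron_le1 m n)) [b [rb b1 bE]].
by rewrite (@occupied_eq a b) // => j; rewrite aE bE.
Qed.

Theorem theorem5p14 (N : nat) (hN : (2 <= N)%N) (a : state) :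
  (reachable (flat_clusteron 0 N) a /\ final a) <->
  [\/ has_shadow a (F N 1) /\ leftmost a (- N%:Z + 1),
      has_shadow a (F N (N - 1)) /\ leftmost a (-1) |
      exists (r : nat) (k : int),
        [/\ (1 <= r <= N - 1)%N, - N%:Z + 2 <= k <= -2,
            has_shadow a (F N r) & leftmost a k]].
Proof.
rewrite (reachable_final_gapped 0 a hN); split.
  move=> [L [r [Lr a1 aE]]].
  have rN : (1 <= r < N)%N by case/andP: Lr.
  have [sh lm] := (shadow_gapped a (0 - L%:Z) rN).2 (conj a1 aE).
  case/andP: Lr => _ /or3P[/andP[/eqP LE /eqP rE]|/andP[/eqP LE /eqP rE]|LN].
  - by apply: Or32; rewrite subn1 -rE; rewrite LE in lm.
  - apply: Or31; rewrite -rE; split=> //.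
    by rewrite (_ : - N%:Z + 1 = 0 - L%:Z) //; lia.
  - by apply: Or33; exists r, (0 - L%:Z); split=> //; lia.
case=> [[sh lm]|[sh lm]|[r [k [rN kN sh lm]]]].
- have rN : (1 <= 1 < N)%N by lia.
  have [a1 aE] := (shadow_gapped a (- N%:Z + 1) rN).1 (conj sh lm).
  exists N.-1, 1%N; split=> // [|j]; first by rewrite /attainable; lia.
  by rewrite aE; congr gapped; lia.
- have rN : (1 <= N - 1 < N)%N by lia.
  have [a1 aE] := (shadow_gapped a (-1) rN).1 (conj sh lm).
  exists 1%N, (N - 1)%N; split=> //; rewrite /attainable; lia.
- have rN' : (1 <= r < N)%N by lia.
  have [a1 aE] := (shadow_gapped a k rN').1 (conj sh lm).
  exists `|k|%N, r; split=> // [|j]; first by rewrite /attainable; lia.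
  by rewrite aE; congr gapped; lia.
Qed.
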